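(* Let $\mathsf{G}$ be a compact Lie group acting orthogonally (by linear isometries) on $\mathbb{R}^n$, and let $S\subset\mathbb{R}^n$ be a spectrahedron that is $\mathsf{G}$-invariant, i.e., $g\cdot S= S$ for all $g\in\mathsf{G}$. Then there exist a $\mathsf{G}$-representation $V$ (finite-dimensional, real, orthogonal) and a $\mathsf{G}$-equivariant affine-linear map $\overline{M}\colon\mathbb{R}^n\to\operatorname{Sym}^2(V)$ such that \[ S=\{x\in\mathbb{R}^n : \overline{M}(x)\succeq 0\}. \]
   Context: $\operatorname{Sym}^2(\mathbb{R}^d)$ denotes the real vector space of symmetric $d\times d$ matrices, and $A\succeq 0$ means that $A$ is positive-semidefinite. A set $S\subset\mathbb{R}^n$ is a spectrahedron if there is some $d$ and an affine-linear map $M\colon\mathbb{R}^n\to\operatorname{Sym}^2(\mathbb{R}^d)$, i.e., $M(x)=M_0+x_1M_1+\dots+x_nM_n$ with $M_j\in\operatorname{Sym}^2(\mathbb{R}^d)$, such that $S=\{x\in\mathbb{R}^n: M(x)\succeq0\}$. For a finite-dimensional real orthogonal $\mathsf{G}$-representation $V$, $\operatorname{Sym}^2(V)$ is the space of symmetric bilinear maps $Q\colon V\times V\to\mathbb{R}$ (identified with symmetric matrices after choosing an orthonormal basis), with $\mathsf{G}$-action $(g\cdot Q)(\varphi,\psi)=Q(g^{-1}\cdot\varphi,g^{-1}\cdot\psi)$ (i.e., conjugation in terms of matrices); $Q\succeq0$ means $Q(\varphi,\varphi)\ge0$ for all $\varphi\in V$. The map $\overline{M}$ is $\mathsf{G}$-equivariant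 if $\overline{M}(g\cdot x)=g\cdot\overline{M}(x)$ for all $g\in\mathsf{G}$, $x\in\mathbb{R}^n$. *)

(* Defs.v *)
From HB Require Import structures.
From mathcomp Require Import all_boot all_order all_algebra.
From mathcomp Require Import all_classical all_reals all_analysis.

Set Implicit Arguments.
Unset Strict Implicit.
Unset Printing Implicit Defensive.

Import Order.TTheory GRing.Theory Num.Theory.
Import numFieldNormedType.Exports.

Local Open Scope classical_set_scope.
Local Open Scope ring_scope.

(* [groupType] is the class of multiplicative, possibly infinite groups. *)
HB.mixin Record Group_isTopological G of Group G & Topological G := {
  mulg_cts : continuous (fun xy : G * G => (xy.1 * xy.2)%g) ;
  invg_cts : continuous (fun x : G => x^-1%g)
}.

#[short(type="topologicalGroupType")]
HB.structure Definition TopologicalGroup :=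
  {G of Group_isTopological G & Group G & Topological G}.

(* On an open subset U of a finite-dimensional space, f is C^(k+1) iff all its
   directional derivatives exist on U and are C^k there. *)
Fixpoint Ck_on (R : realType) (E F : normedModType R) (k : nat)
    (U : set E) (f : E -> F) : Prop :=
  (forall x, U x -> {for x, continuous f}) /\
  (if k is k'.+1 then
     forall v : E, (forall x, U x -> derivable f x v) /\
                   Ck_on k' U (fun x => 'D_v f x)
   else True).

Definition smooth_on (R : realType) (E F : normedModType R)
    (U : set E) (f : E -> F) : Prop :=
  forall k, Ck_on k U f.

(* The function and its inverse are total; only their values on [chart_dom] and
   on its image are meaningful. *)
Record chart (R : realType) (m : nat) (T : topologicalType) := Chart {
  chart_dom : set T ;
  chart_fun :> T -> 'rV[R]_m ;
  chart_inv : 'rV[R]_m -> T ;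
  chart_dom_open : open chart_dom ;
  chart_img_open : open (chart_fun @` chart_dom) ;
  chart_funK : forall t, chart_dom t -> chart_inv (chart_fun t) = t ;
  chart_fun_cts : {within chart_dom, continuous chart_fun} ;
  chart_inv_cts : {within chart_fun @` chart_dom, continuous chart_inv}
}.

Definition chart_img (R : realType) (m : nat) (T : topologicalType)
    (a : chart R m T) : set 'rV[R]_m := a @` chart_dom a.

Definition smooth_atlas (R : realType) (m : nat) (T : topologicalType)
    (A : set (chart R m T)) : Prop :=
  (forall t, exists2 a, A a & chart_dom a t) /\
  (forall a b, A a -> A b ->
     smooth_on (a @` (chart_dom a `&` chart_dom b))
               (fun u => b (chart_inv a u))).

HB.mixin Record TopologicalGroup_isLie (R : realType) G
    of TopologicalGroup G := {
  lie_dim : nat ;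
  lie_atlas : set (chart R lie_dim G) ;
  lie_hausdorff : hausdorff_space G ;
  lie_second_countable : @second_countable G ;
  lie_atlasP : smooth_atlas lie_atlas ;
  lie_mul_smooth : forall a b c : chart R lie_dim G,
    lie_atlas a -> lie_atlas b -> lie_atlas c ->
    smooth_on
      [set u : 'rV[R]_lie_dim * 'rV[R]_lie_dim |
        [/\ chart_img a u.1, chart_img b u.2 &
            chart_dom c (chart_inv a u.1 * chart_inv b u.2)%g]]
      (fun u => c (chart_inv a u.1 * chart_inv b u.2)%g) ;
  lie_inv_smooth : forall a b : chart R lie_dim G,
    lie_atlas a -> lie_atlas b ->
    smooth_on
      [set u : 'rV[R]_lie_dim |
        chart_img a u /\ chart_dom b (chart_inv a u)^-1%g]
      (fun u => b (chart_inv a u)^-1%g)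
}.

#[short(type="lieGroupType")]
HB.structure Definition LieGroup (R : realType) :=
  {G of TopologicalGroup_isLie R G & TopologicalGroup G}.

(* A finite-dimensional real orthogonal representation, in an orthonormal
   basis: g acts on 'cV[R]_k by v |-> rho g *m v.  As usual for representations
   of Lie groups, only continuity is required, smoothness being automatic. *)
Record orthogonal_rep (R : realType) (G : topologicalGroupType) (k : nat) :=
  OrthogonalRep {
    rep_mx :> G -> 'M[R]_k ;
    rep_mx1 : rep_mx 1%g = 1%:M ;
    rep_mxM : forall g h, rep_mx (g * h)%g = rep_mx g *m rep_mx h ;
    rep_mx_orthogonal : forall g, (rep_mx g)^T *m rep_mx g = 1%:M ;
    rep_mx_cts : continuous rep_mx
  }.

(* The Gram matrix of (phi, psi) |-> Q (g^-1 . phi) (g^-1 . psi), where A is the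
   Gram matrix of Q; by orthogonality it equals
   rho g *m A *m (rho g)^-1. *)
Definition sym2_act (R : realType) (G : topologicalGroupType) (k : nat)
    (rho : orthogonal_rep R G k) (g : G) (A : 'M[R]_k) : 'M[R]_k :=
  (rho g^-1%g)^T *m A *m rho g^-1%g.

Definition psdmx (R : realType) (d : nat) (A : 'M[R]_d) : Prop :=
  forall v : 'cV[R]_d, 0 <= (v^T *m A *m v) 0 0.

Record sym_affine_map (R : realType) (n d : nat) := SymAffineMap {
  sam_const : 'M[R]_d ;
  sam_coef : 'I_n -> 'M[R]_d ;
  sam_const_sym : sam_const^T = sam_const ;
  sam_coef_sym : forall j, (sam_coef j)^T = sam_coef j
}.

Definition sam_eval (R : realType) (n d : nat) (M : sym_affine_map R n d)
    (x : 'cV[R]_n) : 'M[R]_d :=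
  sam_const M + \sum_(j < n) x j 0 *: sam_coef M j.

Coercion sam_eval : sym_affine_map >-> Funclass.

Definition spectrahedron (R : realType) (n : nat) (S : set 'cV[R]_n) : Prop :=
  exists (d : nat) (M : sym_affine_map R n d), S = [set x | psdmx (M x)].

(* Main.v *)
Require Import Defs.
From HB Require Import structures.
From mathcomp Require Import all_boot all_order all_algebra.
From mathcomp Require Import all_classical all_reals all_analysis.
From mathcomp Require Import perm ring lra mxtens.

Set Implicit Arguments.
Unset Strict Implicit.
Unset Printing Implicit Defensive.

Import Order.TTheory GRing.Theory Num.Theory.
Import numFieldNormedType.Exports.

Local Open Scope classical_set_scope.
Local Open Scope ring_scope.

(** Average over [g] in [G] the quadratic forms
  [phi |-> phi(g)^T M(g^-1 x) phi(g)] on a finite-dimensional space of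
  polynomial functions [phi] on [G].  The average is equivariant, and psd
  when [x] is in [S].  For [x] outside [S] one needs a [phi] of bounded degree
  that makes it negative.  Let [xb] be a fixed point in the relative
  interior of [S] and [y] the last point of the segment from [xb] to [x] that
  lies in [S].  By invariance [M (g^-1 y)] drops rank for every [g], and a
  kernel vector can be chosen polynomially in [g] and uniformly bounded in
  degree, by applying to [M (g^-1 y)] its characteristic polynomial divided by
  a power of the variable.  Affineness along the segment makes the form of this
  [phi] negative at [x].  Points off the affine hull of [S] are separated by an
  extra block of the pencil, [kerblock].

  No Haar measure is needed: the mean of a matrix coefficient is read off the
  point of least norm in the closed convex hull of an orbit. *)

(** * Quadratic forms and positive semidefinite matrices *)

Definition bil (R : realType) d (A : 'M[R]_d) (v w : 'cV[R]_d) : R :=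
  (v^T *m A *m w) 0 0.

Section Bilinear.
Variables (R : realType) (d : nat).
Implicit Types (A B X N Z : 'M[R]_d) (u v w : 'cV[R]_d) (c : R).

Lemma bilE A v w : bil A v w = \sum_i \sum_j v i 0 * A i j * w j 0.
Proof.
rewrite /bil mxE exchange_big; apply: eq_bigr => j _.
by rewrite mxE mulr_suml; apply: eq_bigr => i _; rewrite !mxE.
Qed.

Lemma bilDr A u v w : bil A u (v + w) = bil A u v + bil A u w.
Proof. by rewrite /bil mulmxDr mxE. Qed.

Lemma bilDl A u v w : bil A (u + v) w = bil A u w + bil A v w.
Proof. by rewrite /bil linearD/= !mulmxDl mxE. Qed.

Lemma bilZr A c v w : bil A v (c *: w) = c * bil A v w.
Proof. by rewrite /bil -scalemxAr mxE. Qed.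

Lemma bilZl A c v w : bil A (c *: v) w = c * bil A v w.
Proof. by rewrite /bil linearZ/= -!scalemxAl mxE. Qed.

Lemma bilDm A B v w : bil (A + B) v w = bil A v w + bil B v w.
Proof. by rewrite /bil mulmxDr mulmxDl mxE. Qed.

Lemma bilZm c A v w : bil (c *: A) v w = c * bil A v w.
Proof. by rewrite /bil -scalemxAr -scalemxAl mxE. Qed.

Lemma bil_sym A v w : A^T = A -> bil A v w = bil A w v.
Proof.
move=> As; have -> : bil A v w = (v^T *m A *m w)^T 0 0 by rewrite mxE.
by rewrite !trmx_mul trmxK As mulmxA.
Qed.

Lemma bilMM p A (B : 'M[R]_(d, p)) (v w : 'cV[R]_p) :
  bil A (B *m v) (B *m w) = bil (B^T *m A *m B) v w.
Proof. by rewrite /bil trmx_mul !mulmxA. Qed.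

(** Cauchy-Schwarz for a semidefinite form, from its nonnegativity on the plane spanned by [v] and
    [w]. *)
Lemma bil_psd_le A v w : A^T = A -> psdmx A ->
  bil A w v ^+ 2 <= bil A w w * bil A v v.
Proof.
move=> As Ap.
set a := bil A v v; set b := bil A w v; set c := bil A w w.
have E s t : 0 <= s ^+ 2 * c + 2 * s * t * b + t ^+ 2 * a.
  have := Ap (s *: w + t *: v); rewrite -/(bil _ _ _).
  rewrite bilDr !bilDl !bilZr !bilZl (bil_sym v w As) -/a -/b -/c.
  by congr (0 <= _); ring.
have a0 : 0 <= a by have := E 0 1; rewrite !expr0n !mul0r/=; lra.
have := a0; rewrite le_eqVlt => /predU1P[a0'|a_gt0].
  rewrite -a0' mulr0; have [->|b0] := eqVneq b 0; first by rewrite expr0n.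
  (* With [a = 0] the form is affine in [t]; this [t] gives it the value -1. *)
  have := E 1 (- (c + 1) / (2 * b)); rewrite -a0' => H.
  suff : 0 <= - 1 :> R by lra.
  apply: le_trans H _; rewrite le_eqVlt; apply/orP; left; apply/eqP.
  by field.
have := E a (- b); rewrite (_ : _ + _ = a * (c * a - b ^+ 2)); last by ring.
by rewrite pmulr_rge0// subr_ge0.
Qed.

Lemma mulmx_trmx_eq0 p (B : 'M[R]_(d, p)) : B^T *m B = 0 -> B = 0.
Proof.
move=> B0; apply/matrixP => i j; rewrite mxE.
have /eqP := congr1 (fun C : 'M[R]_p => C j j) B0; rewrite !mxE.
rewrite psumr_eq0; last by move=> k _; rewrite mxE -expr2 sqr_ge0.
move=> /allP /(_ i); rewrite mem_index_enum => /(_ isT).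
by rewrite mxE /= -expr2 sqrf_eq0 => /eqP.
Qed.

(** Cauchy-Schwarz against [w = A *m v], for which [bil A w v] is the squared norm of [A *m v]. *)
Lemma psd_bil_eq0 A v : A^T = A -> psdmx A -> bil A v v = 0 -> A *m v = 0.
Proof.
move=> As Ap v0; apply: mulmx_trmx_eq0.
have := bil_psd_le v (A *m v) As Ap; rewrite v0 mulr0 => H.
have : bil A (A *m v) v = 0.
  by apply/eqP; rewrite -sqrf_eq0 eq_le H sqr_ge0.
rewrite /bil -mulmxA => H'.
by apply/matrixP => i j; rewrite !ord1 H' mxE.
Qed.

Lemma psd_bil_gt0 A v : A^T = A -> psdmx A -> A *m v != 0 -> 0 < bil A v v.
Proof.
move=> As Ap /eqP v0; rewrite lt_neqAle (Ap v) andbT eq_sym.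
by apply/eqP => /(psd_bil_eq0 As Ap).
Qed.

(** Sum of the Cauchy-Schwarz inequalities of [v] against the basis vectors. *)
Lemma psd_norm_mul_le A v : A^T = A -> psdmx A ->
  bil 1%:M (A *m v) (A *m v) <= \tr A * bil A v v.
Proof.
move=> As Ap; rewrite [leLHS]/bil mulmx1 mxE /mxtrace mulr_suml.
apply: ler_sum => i _; rewrite mxE -expr2.
have := bil_psd_le v (delta_mx i 0) As Ap; congr (_ ^+ 2 <= _ * _).
  by rewrite /bil trmx_delta -rowE -row_mul !mxE.
by rewrite /bil trmx_delta -rowE -colE !mxE.
Qed.

Lemma bil_ge_norm A : exists2 c, 0 <= c &
  forall v, - (c * bil 1%:M v v) <= bil A v v.
Proof.
exists (\sum_i \sum_j `|A i j|).
  by apply: sumr_ge0 => i _; apply: sumr_ge0.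
move=> v; rewrite [leRHS]bilE mulr_suml -sumrN ler_sum// => i _.
rewrite mulr_suml -sumrN ler_sum// => j _.
have vv : (v i 0) ^+ 2 <= bil 1%:M v v /\ (v j 0) ^+ 2 <= bil 1%:M v v.
  by split; rewrite /bil mulmx1 mxE;
   [rewrite (bigD1 i)//= | rewrite (bigD1 j)//=];
   rewrite mxE -expr2 lerDl sumr_ge0// => k _; rewrite mxE -expr2 sqr_ge0.
have h : `|v i 0 * v j 0| <= bil 1%:M v v.
  case: vv; set x := v i 0; set y := v j 0; set s := bil _ _ _ => hx hy.
  rewrite ler_norml; apply/andP; split.
    by have := sqr_ge0 (x + y); rewrite sqrrD; lra.
  by have := sqr_ge0 (x - y); rewrite sqrrB; lra.
have := ler_wpM2l (normr_ge0 (A i j)) h; rewrite -normrM.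
have := ler_norm (- (A i j * (v i 0 * v j 0))); rewrite normrN; lra.
Qed.

(** The columns of [cokermx B] are killed by [B], hence by [A]. *)
Lemma sub_ker_submx A B :
  (forall v : 'cV[R]_d, B *m v = 0 -> A *m v = 0) -> (A <= B)%MS.
Proof.
move=> kerBA; rewrite submxE; apply/eqP/matrixP => i j.
have : A *m col j (cokermx B) = 0.
  by apply: kerBA; rewrite colE mulmxA mulmx_coker mul0mx.
rewrite colE mulmxA -colE; move: (cokermx _) => C /matrixP/(_ i 0).
by rewrite !mxE.
Qed.

(** Since [N] factors as [X *m K *m X], its form at [v] depends only on [X *m v], and is bounded
    below by a negative multiple of the squared norm of [X *m v], which [psd_norm_mul_le] compares
    with the form of [X]. *)
Lemma psd_perturb X N : X^T = X -> N^T = N -> psdmx X -> (N <= X)%MS ->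
  exists2 s, 0 < s & psdmx (X + s *: N).
Proof.
move=> Xs Ns Xp NX.
have [D ND] := submxP NX.
have NE : N = X *m (pinvmx X *m D) *m X.
  have NDT : N = X *m D^T by rewrite -{1}Ns ND trmx_mul Xs.
  have XpN : X *m pinvmx X *m N = N.
    by rewrite {1}NDT mulmxA mulmxKpV// -NDT.
  by rewrite -[LHS]XpN {1}ND !mulmxA.
have [c c0 hc] := bil_ge_norm (pinvmx X *m D).
have t0 : 0 <= \tr X.
  rewrite /mxtrace sumr_ge0// => i _.
  have := Xp (delta_mx i 0); rewrite trmx_delta -rowE -colE !mxE.
  by [].
(* The form of [N] is at least [- c * \tr X] times that of [X]; adding 1 keeps the denominator
   positive. *)
exists (c * \tr X + 1)^-1; first by rewrite invr_gt0 ltr_wpDl// mulr_ge0.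
move=> v; rewrite -/(bil _ _ _) bilDm bilZm.
set s := _^-1.
have s0 : 0 < s by rewrite invr_gt0 ltr_wpDl// mulr_ge0.
have NE' : bil N v v = bil (pinvmx X *m D) (X *m v) (X *m v).
  by rewrite bilMM Xs NE !mulmxA.
have h1 := hc (X *m v); rewrite -NE' in h1.
have h2 : c * bil 1%:M (X *m v) (X *m v) <= c * (\tr X * bil X v v).
  by rewrite ler_wpM2l// psd_norm_mul_le.
have h3 : s * - (c * \tr X * bil X v v) <= s * bil N v v.
  by rewrite ler_wpM2l ?(ltW s0)//; lra.
have sE : s * (c * \tr X + 1) = 1.
  by rewrite mulVf// gt_eqF// ltr_wpDl// mulr_ge0.
have h4 : 0 <= s * bil X v v by rewrite mulr_ge0 ?(ltW s0)//; exact: Xp.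
have : s * (c * \tr X * bil X v v) + s * bil X v v = bil X v v.
  by rewrite -[RHS]mul1r -sE; ring.
lra.
Qed.

(** The supremum of the good parameters is attained, because each vector imposes a non-strict affine
    inequality on the parameter. *)
Lemma psd_segment_last Z N : psdmx Z -> ~ psdmx (Z + N) ->
  exists t, [/\ 0 <= t < 1, psdmx (Z + t *: N) &
    forall s, t < s <= 1 -> ~ psdmx (Z + s *: N)].
Proof.
move=> Zp nZN.
pose T := [set t : R | 0 <= t <= 1 /\ psdmx (Z + t *: N)].
have T0 : T 0 by rewrite /T/= lexx ler01 scale0r addr0.
have Tsup : has_sup T.
  by split; [exists 0 | exists 1 => t [/andP[]]].
pose t := sup T.
have Tt (u : R) : T u -> u <= t.
  by move=> Tu; apply: ub_le_sup => //; case: Tsup.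
have t0 : 0 <= t by apply: Tt.
have t1 : t <= 1 by apply: ge_sup => [|u [/andP[]]//]; exists 0.
have tp : psdmx (Z + t *: N).
  move=> v; rewrite -/(bil _ _ _) bilDm bilZm leNgt; apply/negP => h.
  have Zv : 0 <= bil Z v v by exact: Zp.
  have Nv : bil N v v < 0.
    rewrite ltNge; apply/negP => Nv.
    by have := mulr_ge0 t0 Nv; lra.
  (* The right-hand side is the parameter at which the form vanishes at [v], an upper bound of
     [T]. *)
  have : t <= bil Z v v / - bil N v v.
    apply: ge_sup; first by exists 0.
    move=> u [_ /(_ v)]; rewrite -/(bil _ _ _) bilDm bilZm => hu.
    by rewrite ler_pdivlMr ?oppr_gt0//; lra.
  by rewrite ler_pdivlMr ?oppr_gt0//; lra.
exists t; split => //.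
  rewrite t0 lt_neqAle t1 andbT; apply/eqP => t1'; apply: nZN.
  by have := tp; rewrite t1' scale1r.
move=> s /andP[ts s1] sp; have : s <= t.
  by apply: Tt; split => //; rewrite s1 (ltW (le_lt_trans t0 ts)).
by rewrite leNgt ts.
Qed.

(* Without such a kernel vector, [psd_perturb] would extend the segment. *)
Lemma psd_segment_kernel Z N t : Z^T = Z -> N^T = N -> psdmx Z ->
  kermx Z *m N = 0 -> 0 <= t < 1 -> psdmx (Z + t *: N) ->
  (forall s, t < s <= 1 -> ~ psdmx (Z + s *: N)) ->
  exists2 v, (Z + t *: N) *m v = 0 & 0 < bil Z v v.
Proof.
move=> Zs Ns Zp ZN /andP[t0 t1] tp tmax.
have Xs : (Z + t *: N)^T = Z + t *: N by rewrite linearD/= linearZ/= Zs Ns.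
apply: contrapT => /forall2NP h.
have kerZ v : (Z + t *: N) *m v = 0 -> Z *m v = 0.
  move=> Xv; apply/eqP/negPn/negP => Zv; case: (h v) => //.
  by apply; exact: psd_bil_gt0.
have kerN v : Z *m v = 0 -> N *m v = 0.
  move=> Zv; have : (v^T <= kermx Z)%MS.
    by apply/sub_kermxP; rewrite -Zs -trmx_mul Zv trmx0.
  move=> /submxP[D vD]; rewrite -[v]trmxK -Ns -trmx_mul vD -mulmxA ZN.
  by rewrite mulmx0 trmx0.
have NX : (N <= (Z + t *: N)%R)%MS by apply: sub_ker_submx => v /kerZ/kerN.
have [s s0 sp] := psd_perturb Xs Ns tp NX.
pose r := Num.min s (1 - t).
have r0 : 0 < r by rewrite lt_min s0 subr_gt0.
have rs : r <= s by rewrite ge_min lexx.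
have rt : r <= 1 - t by rewrite ge_min lexx orbT.
apply: (tmax (t + r)); first by apply/andP; split; lra.
move=> v; rewrite -/(bil _ _ _).
have h1 := sp v; have h2 := tp v.
rewrite -/(bil _ _ _) !bilDm !bilZm in h1.
rewrite -/(bil _ _ _) !bilDm !bilZm in h2.
rewrite bilDm bilZm.
(* Where [N] is nonnegative, going further than [t] does no harm; where it is negative, [r <= s]
   loses at most what the step [s] does. *)
have [Nv|Nv] := leP 0 (bil N v v).
  have := mulr_ge0 (ltW r0) Nv; lra.
have : s * bil N v v <= r * bil N v v by rewrite ler_nM2r.
lra.
Qed.

End Bilinear.

(** * Projection onto the kernel as a polynomial in a symmetric matrix *)

Section KernelPolynomial.
Variables (R : realType) (d : nat) (X : 'M[R]_d.+1).
Hypothesis Xs : X^T = X.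

(** A symmetric matrix has no nilpotent part: if [X ^+ k.+2 *m B = 0], the Gram matrix of
    [X ^+ k.+1 *m B] is [B^T *m X ^+ k *m X ^+ k.+2 *m B], which vanishes. *)
Lemma sym_exp_mul_eq0 p k (B : 'M[R]_(d.+1, p)) :
  X ^+ k *m B = 0 -> X *m B = 0.
Proof.
elim: k => [|k IH]; first by rewrite mul1mx => ->; rewrite mulmx0.
case: k IH => [|k] IH; first by rewrite expr1.
move=> h; apply: IH; apply: mulmx_trmx_eq0.
have Xks : (X ^+ k.+1)^T = X ^+ k.+1.
  by elim: k.+1 => [|j IHj]; rewrite ?trmx1// {1}exprS trmx_mul IHj Xs exprSr.
have E : X ^+ k.+1 * X ^+ k.+1 = X ^+ k * X ^+ k.+2 by rewrite -!exprD addSnnS.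
have {}E : X ^+ k.+1 *m X ^+ k.+1 = X ^+ k *m X ^+ k.+2 := E.
rewrite trmx_mul Xks -mulmxA (mulmxA (X ^+ k.+1)) E -(mulmxA (X ^+ k)) h.
by rewrite !mulmx0.
Qed.

(* When [k] is the multiplicity of the root 0 of the characteristic polynomial,
   this is a nonzero multiple of the projection onto the kernel of [X]. *)
Definition kerproj k : 'M[R]_d.+1 := horner_mx X (drop_poly k (char_poly X)).

(** By Cayley-Hamilton [X ^+ k] kills [kerproj k], and symmetry reduces the power to 1. *)
Lemma mul_kerproj k : (forall i, (i < k)%N -> (char_poly X)`_i = 0) ->
  X *m kerproj k = 0.
Proof.
move=> lowk; apply: (@sym_exp_mul_eq0 _ k).
have -> : X ^+ k = horner_mx X 'X^k by rewrite rmorphXn/= horner_mx_X.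
rewrite -[_ *m _]rmorphM/= mulrC -[RHS](Cayley_Hamilton X).
congr (horner_mx X _); rewrite -{2}[char_poly X](poly_take_drop k).
rewrite [take_poly _ _](_ : _ = 0) ?add0r//.
by apply/polyP => i; rewrite coef_take_poly coef0; case: ifP => // /lowk.
Qed.

(** On the kernel of [X] a polynomial in [X] acts as its constant coefficient. *)
Lemma kerproj_mul k p (B : 'M[R]_(d.+1, p)) : X *m B = 0 ->
  kerproj k *m B = (char_poly X)`_k *: B.
Proof.
move=> XB; have E : (char_poly X)`_k = (drop_poly k (char_poly X))`_0.
  by rewrite coef_drop_poly add0n.
rewrite /kerproj E; elim/poly_ind: (drop_poly _ _) => [|q c _].
  by rewrite rmorph0 mul0mx coef0 scale0r.
rewrite rmorphD rmorphM/= horner_mx_X horner_mx_C mulmxDl -[_ * X *m B]mulmxA.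
by rewrite XB mulmx0 add0r coefD coefMX/= coefC/= add0r mul_scalar_mx.
Qed.

End KernelPolynomial.

(** * Orthogonal representations and averages of orbits *)

Section Continuity.
Variables (R : realType) (T : topologicalType).

Lemma continuous_mx m n (f : T -> 'M[R]_(m, n)) :
  (forall i j, continuous (fun x => f x i j)) -> continuous f.
Proof.
move=> fc x A [P HP sPA].
have H : \forall y \near x, forall i j, P i j (f y i j).
  by apply: filter_forall => i; apply: filter_forall => j; apply: fc.
by apply: filterS H => y Py; apply: sPA.
Qed.

Lemma continuous_coord m n (f : T -> 'M[R]_(m, n)) i j :
  continuous f -> continuous (fun x => f x i j).
Proof.
move=> fc x; apply: (@continuous_comp _ _ _ f (fun M : 'M[R]_(m, n) => M i j)).
  exact: fc.
exact: coord_continuous.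
Qed.

Lemma continuous_sum n (f : 'I_n -> T -> R) :
  (forall i, continuous (f i)) -> continuous (fun x => \sum_i f i x).
Proof.
move=> fc; have addc : continuous (fun x : R * R => x.1 + x.2).
  exact: add_continuous.
exact: (continuous_big addc (fun i _ => fc i)).
Qed.

Lemma continuous_mul (f g : T -> R) :
  continuous f -> continuous g -> continuous (fun x => f x * g x).
Proof. by move=> fc gc x; apply: continuousM; [exact: fc | exact: gc]. Qed.

Lemma continuous_mulmx m n p (f : T -> 'M[R]_(m, n)) (g : T -> 'M[R]_(n, p)) :
  continuous f -> continuous g -> continuous (fun x => f x *m g x).
Proof.
move=> fc gc; apply: continuous_mx => i j.
rewrite (_ : (fun x => _) = (fun x => \sum_k f x i k * g x k j)).
  by apply: continuous_sum => k; apply: continuous_mul; exact: continuous_coord.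
by apply/funext => x; rewrite mxE.
Qed.

End Continuity.

Section Representations.
Variables (R : realType) (G : topologicalGroupType).

Lemma rep_mxVK k (U : orthogonal_rep R G k) g : U g^-1%g *m U g = 1%:M.
Proof. by rewrite -rep_mxM mulVg rep_mx1. Qed.

Lemma rep_mxV k (U : orthogonal_rep R G k) g : U g^-1%g = (U g)^T.
Proof.
rewrite -[LHS]mulmx1 -(mulmx1C (rep_mx_orthogonal U g)) mulmxA rep_mxVK.
by rewrite mul1mx.
Qed.

Section Trivial.
Variable k : nat.

Lemma triv_rep_orthogonal : (1%:M : 'M[R]_k)^T *m 1%:M = 1%:M.
Proof. by rewrite trmx1 mulmx1. Qed.

Definition triv_rep : orthogonal_rep R G k :=
  @OrthogonalRep R G k (fun=> 1%:M) erefl (fun _ _ => esym (mulmx1 _))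
    (fun=> triv_rep_orthogonal) (@cst_continuous _ _ _).

End Trivial.

Section DirectSum.
Variables (k l : nat) (U : orthogonal_rep R G k) (V : orthogonal_rep R G l).

Let sum_mx g := block_mx (U g) 0 0 (V g).

Lemma sum_rep1 : sum_mx 1%g = 1%:M.
Proof. by rewrite /sum_mx !rep_mx1 -scalar_mx_block. Qed.

Lemma sum_repM g h : sum_mx (g * h)%g = sum_mx g *m sum_mx h.
Proof.
by rewrite /sum_mx mulmx_block !mul0mx !mulmx0 !addr0 add0r !rep_mxM.
Qed.

Lemma sum_rep_orthogonal g : (sum_mx g)^T *m sum_mx g = 1%:M.
Proof.
rewrite /sum_mx tr_block_mx !trmx0 mulmx_block !mul0mx !mulmx0 !addr0 add0r.
by rewrite !rep_mx_orthogonal -scalar_mx_block.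
Qed.

Lemma sum_rep_cts : continuous sum_mx.
Proof.
apply: continuous_mx => i j.
case: (split_ordP i) => i' ->; case: (split_ordP j) => j' ->.
- under eq_fun do rewrite block_mxEul.
  by apply: continuous_coord; exact: rep_mx_cts.
- by under eq_fun do rewrite block_mxEur mxE; exact: cst_continuous.
- by under eq_fun do rewrite block_mxEdl mxE; exact: cst_continuous.
- under eq_fun do rewrite block_mxEdr.
  by apply: continuous_coord; exact: rep_mx_cts.
Qed.

Definition sum_rep : orthogonal_rep R G (k + l) :=
  OrthogonalRep sum_rep1 sum_repM sum_rep_orthogonal sum_rep_cts.

End DirectSum.

Lemma tensmx1 k l : (1%:M : 'M[R]_k) *t (1%:M : 'M[R]_l) = 1%:M.
Proof.
apply/matrixP => i j.
case: (mxtens_indexP i) => i1 i2; case: (mxtens_indexP j) => j1 j2.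
rewrite tensmxE !mxE -natrM mulnb.
by rewrite -xpair_eqE (inj_eq (can_inj (@mxtens_indexK _ _))).
Qed.

Section Tensor.
Variables (k l : nat) (U : orthogonal_rep R G k) (V : orthogonal_rep R G l).

Let tens_mx g := U g *t V g.

Lemma tens_rep1 : tens_mx 1%g = 1%:M.
Proof. by rewrite /tens_mx !rep_mx1 tensmx1. Qed.

Lemma tens_repM g h : tens_mx (g * h)%g = tens_mx g *m tens_mx h.
Proof. by rewrite /tens_mx !rep_mxM tensmx_mul. Qed.

Lemma tens_rep_orthogonal g : (tens_mx g)^T *m tens_mx g = 1%:M.
Proof. by rewrite /tens_mx trmx_tens tensmx_mul !rep_mx_orthogonal tensmx1. Qed.

Lemma tens_rep_cts : continuous tens_mx.
Proof.
apply: continuous_mx => i j; rewrite /tens_mx /tensmx.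
under eq_fun do rewrite mxE.
by apply: continuous_mul; apply: continuous_coord; exact: rep_mx_cts.
Qed.

Definition tens_rep : orthogonal_rep R G (k * l) :=
  OrthogonalRep tens_rep1 tens_repM tens_rep_orthogonal tens_rep_cts.

End Tensor.

(* [A] is the point of least norm in the closed convex hull of the orbit of [b],
   the hull being described by the affine inequalities valid on the orbit. *)
Lemma rep_average k (U : orthogonal_rep R G k) (b : 'cV[R]_k) :
  exists A : 'cV[R]_k, (forall g, U g *m A = A) /\
    forall (l : 'rV[R]_k) c, (forall g, c <= (l *m (U g *m b)) 0 0) ->
      c <= (l *m A) 0 0.
Proof.
pose f (l : 'rV[R]_k) (y : 'rV[R]_k) : R := (l *m y^T) 0 0.
pose D := [set lc : 'rV[R]_k * R |
  forall g, lc.2 <= (lc.1 *m (U g *m b)) 0 0].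
pose C := \bigcap_(lc in D) [set y | lc.2 <= f lc.1 y].
have tr_cts : continuous (fun y : 'rV[R]_k => y^T).
  apply: continuous_mx => i j; under eq_fun do rewrite mxE.
  exact: coord_continuous.
have f_cts l : continuous (f l).
  apply: continuous_coord; apply: continuous_mulmx tr_cts.
  exact: cst_continuous.
have Ccl : closed C.
  apply: closed_bigI => lc _.
  have fc : {in ~` f lc.1 @^-1` [set x | lc.2 <= x], continuous (f lc.1)}.
    by move=> y _; exact: f_cts.
  by apply: (preimage_closed fc); exact: closed_ge.
pose N (y : 'rV[R]_k) : R := (y *m y^T) 0 0.
have NE y : N y = \sum_j y 0 j ^+ 2.
  by rewrite /N mxE; apply: eq_bigr => j _; rewrite mxE expr2.
have N_cts : continuous N.
  apply: continuous_coord; apply: continuous_mulmx tr_cts.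
  by move=> y; exact: cvg_id.
have NU g (v : 'cV[R]_k) : N (U g *m v)^T = N v^T.
  rewrite /N !trmxK trmx_mul mulmxA -(mulmxA _ _ (U g)).
  by rewrite rep_mx_orthogonal mulmx1.
have Cb : C b^T by move=> [l c] /(_ 1%g)/=; rewrite rep_mx1 mul1mx /f trmxK.
have Ccp : compact C.
  (* Orbit points have squared coordinates at most [N b^T], so [M] bounds the coordinates. These
     bounds are among the inequalities defining [C], which therefore lies in a box. *)
  pose M := 1 + N b^T.
  have cM : compact [set v : 'rV[R]_k | forall i, v ord0 i \in `[(- M), M]].
    apply: (@rV_compact _  _ (fun=> `[(- M), M]%classic)).
    by move=> _; apply: segment_compact.
  apply: subclosed_compact Ccl cM _ => y Cy i.
  have Ub g : - M <= (U g *m b) i 0 <= M.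
    have : ((U g *m b) i 0) ^+ 2 <= N b^T.
      have -> : (U g *m b) i 0 = (U g *m b)^T 0 i by rewrite [RHS]mxE.
      rewrite -(NU g) NE (bigD1 i)//= lerDl.
      by rewrite sumr_ge0// => j _; rewrite sqr_ge0.
    rewrite /M; set x := (_ *m _) i 0; set s := N _ => hx.
    have x2 := sqr_ge0 x.
    by apply/andP; split; [have := sqr_ge0 (x + 1) | have := sqr_ge0 (x - 1)];
      rewrite ?sqrrD ?sqrrB ?mulr1 ?expr1n; lra.
  have h1 : D (delta_mx 0 i, - M).
    by move=> g /=; rewrite -rowE mxE; case/andP: (Ub g).
  have h2 : D (- delta_mx 0 i, - M).
    by move=> g /=; rewrite mulNmx -rowE mxE lerN2 mxE; case/andP: (Ub g).
  have := Cy _ h1; have := Cy _ h2.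
  rewrite /= /f mulNmx -rowE !mxE lerN2 => h3 h4.
  by rewrite in_itv/= h4 h3.
have [y] := compact_EVT_min (ex_intro _ _ Cb) Ccp (continuous_subspaceT N_cts).
rewrite inE => Cy ymin.
exists y^T; split; last by move=> l c lc; exact: (Cy (l, c) lc).
move=> g; pose z := (U g *m y^T)^T.
have Nz : N z = N y by rewrite /z NU trmxK.
(* Precomposing with [U g] permutes the inequalities valid on the orbit. *)
have Cz : C z.
  move=> [l c] lc; rewrite /= /f /z trmxK mulmxA.
  apply: (Cy (l *m U g, c)) => h /=.
  by rewrite -!mulmxA (mulmxA (U g)) -rep_mxM.
have Cm : C (2^-1 *: (y + z)).
  move=> [l c] lc /=; rewrite /f linearZ/= linearD/= -scalemxAr mulmxDr !mxE.
  have /= := Cy _ lc; have /= := Cz _ lc; rewrite /f => h1 h2.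
  have -> : c = 2^-1 * (c + c) by field.
  rewrite ler_pM2l ?invr_gt0//.
  by move: h1 h2; rewrite ![(_ *m _) 0 0]mxE => h1 h2; exact: lerD.
have := ymin _ (mem_set Cm).
(* Parallelogram law: the midpoint would be shorter than [y] unless [z = y]. *)
have E : N (2^-1 *: (y + z)) =
    2^-1 * N y + 2^-1 * N z - 2^-1 * 2^-1 * N (y - z).
  rewrite !NE !mulr_sumr -!big_split -sumrB; apply: eq_bigr => j _ /=.
  by rewrite !mxE; field.
rewrite E Nz => h.
have Nyz : N (y - z) <= 0.
  have q : (0 : R) < 2^-1 by rewrite invr_gt0.
  rewrite leNgt; apply/negP => h'.
  have := mulr_gt0 (mulr_gt0 q q) h'; lra.
have /eqP : N (y - z) = 0.
  apply/eqP; rewrite eq_le Nyz NE sumr_ge0// => j _; exact: sqr_ge0.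
rewrite NE psumr_eq0; last by move=> j _; exact: sqr_ge0.
move=> /allP yz; apply: trmx_inj; rewrite trmxK -/z; apply/rowP => j.
have := yz j; rewrite mem_index_enum => /(_ isT).
by rewrite sqrf_eq0 !mxE subr_eq0 => /eqP ->.
Qed.

(* Finitely many translates of a set where the functional exceeds [c + e] cover
   the group; so the sum of the translates exceeds its
   lower bound uniformly on the orbit. *)
Lemma rep_average_gt k (U : orthogonal_rep R G k) (b A : 'cV[R]_k) :
  compact [set: G] -> (forall g, U g *m A = A) ->
  (forall (l : 'rV[R]_k) c, (forall g, c <= (l *m (U g *m b)) 0 0) ->
      c <= (l *m A) 0 0) ->
  forall (l : 'rV[R]_k) c g0, (forall g, c <= (l *m (U g *m b)) 0 0) ->
    c < (l *m (U g0 *m b)) 0 0 -> c < (l *m A) 0 0.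
Proof.
move=> Gc UA hA l c g0 l0 lg0.
pose f g : R := (l *m (U g *m b)) 0 0.
pose e := (f g0 - c) / 2.
have e0 : 0 < e by rewrite divr_gt0// subr_gt0.
have f_cts : continuous f.
  apply: continuous_coord; apply: continuous_mulmx; first exact: cst_continuous.
  by apply: continuous_mulmx; [exact: rep_mx_cts | exact: cst_continuous].
pose O (h : G) := [set g | c + e < f (h * g)%g].
pose Gp : ptopologicalType := HB.pack G (isPointed.Build G 1%g).
have : cover_compact [set: Gp] by rewrite -compact_cover.
move=> /(_ G setT O)[||F _ GF].
- move=> h _.
  have mul_cts : continuous (fun g : G => (h * g)%g).
    move=> g; apply: (@continuous_comp _ _ _ (fun g : G => (h, g))
      (fun xy : G * G => (xy.1 * xy.2)%g)); last exact: mulg_cts.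
    by apply: cvg_pair; [exact: cvg_cst | exact: cvg_id].
  have fh_cts : {in (fun g : G => f (h * g)%g) @^-1` [set x | c + e < x],
      continuous (fun g : G => f (h * g)%g)}.
    move=> g _; apply: (@continuous_comp _ _ _ (fun g : G => (h * g)%g) f).
      exact: mul_cts.
    exact: f_cts.
  by apply: (open_comp fh_cts); exact: open_gt.
(* This translate moves [g] to [g0], where [f] equals [c + 2 * e]. *)
- move=> g _; exists (g0 * g^-1)%g => //.
  by rewrite /O/= mulgVK /e; move: lg0; rewrite -/(f g0) => lg0; lra.
pose D := finmap.enum_fset F.
have := hA (\sum_(h <- D) l *m U h) (e + \sum_(h <- D) c).
(* As [A] is fixed, every translated functional takes the same value on it. *)
have -> : (\sum_(h <- D) l *m U h) *m A = \sum_(h <- D) l *m A.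
  by rewrite mulmx_suml; apply: eq_bigr => h _; rewrite -mulmxA UA.
have lE h g : (l *m U h *m (U g *m b)) 0 0 = f (h * g)%g.
  by rewrite /f rep_mxM !mulmxA.
move=> H; have {}H : e + \sum_(h <- D) c <= (\sum_(h <- D) l *m A) 0 0.
  apply: H => g; have [h /= hD Oh] := GF g I.
  rewrite mulmx_suml summxE -lerBrDr -sumrB.
  rewrite (bigD1_seq h)/= ?finmap.fset_uniq// lE -[leLHS]addr0.
  apply: lerD; first by rewrite lerBrDl ltW.
  by rewrite sumr_ge0// => h' _; rewrite lE subr_ge0; exact: l0.
rewrite ltNge; apply/negP => lA; move: H; rewrite leNgt => /negP; apply.
rewrite summxE -ltrBlDr -sumrB (le_lt_trans _ e0)// sumr_le0// => h _.
by rewrite subr_le0.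
Qed.

End Representations.

(** * Representative functions and their mean *)

Section RepresentativeFunctions.
Variables (R : realType) (G : topologicalGroupType).
Variables (n : nat) (rho : orthogonal_rep R G n).

(* Level [m] contains the polynomials of degree at most [2 ^ m] in the entries
   of [rho]; doubling the degree lets [polyf_rep] pass from one level to the
   next by a tensor square. *)
Inductive polyf : nat -> (G -> R) -> Prop :=
| polyf_entry i j : polyf 0 (fun g => rho g i j)
| polyf_one m : polyf m (fun=> 1)
| polyf_lin m c f h :
    polyf m f -> polyf m h -> polyf m (fun g => c * f g + h g)
| polyf_mul m f h :
    polyf m f -> polyf m h -> polyf m.+1 (fun g => f g * h g).

Lemma eq_polyf m f h : f =1 h -> polyf m f -> polyf m h.
Proof. by move=> /funext ->. Qed.

Lemma polyf_cst m c : polyf m (fun=> c).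
Proof.
have H := polyf_lin (c - 1) (polyf_one m) (polyf_one m).
by apply: eq_polyf H => g; rewrite mulr1 subrK.
Qed.

Lemma polyf_add m f h :
  polyf m f -> polyf m h -> polyf m (fun g => f g + h g).
Proof.
by move=> pf ph; apply: eq_polyf (polyf_lin 1 pf ph) => g; rewrite mul1r.
Qed.

Lemma polyf_scale m c f : polyf m f -> polyf m (fun g => c * f g).
Proof.
move=> pf; apply: eq_polyf (polyf_lin c pf (polyf_cst m 0)) => g.
by rewrite addr0.
Qed.

Lemma polyf_sum m (I : Type) (s : seq I) (f : I -> G -> R) :
  (forall i, polyf m (f i)) -> polyf m (fun g => \sum_(i <- s) f i g).
Proof.
move=> pf; elim: s => [|i s IH].
  by apply: eq_polyf (polyf_cst m 0) => g; rewrite big_nil.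
by apply: eq_polyf (polyf_add (pf i) IH) => g; rewrite big_cons.
Qed.

(** Multiplication by the constant 1 raises the level. *)
Lemma polyf_le m p f : (m <= p)%N -> polyf m f -> polyf p f.
Proof.
move=> /subnKC <-; elim: (p - m)%N => [|k IH] pf; first by rewrite addn0.
rewrite addnS; apply: eq_polyf (polyf_mul (IH pf) (polyf_one _)) => g.
by rewrite mulr1.
Qed.

Definition polymx m p q (A : G -> 'M[R]_(p, q)) :=
  forall i j, polyf m (fun g => A g i j).

Lemma polymx_cst m p q (A : 'M[R]_(p, q)) : polymx m (fun=> A).
Proof. by move=> i j; exact: polyf_cst. Qed.

Lemma polymx_le m m' p q (A : G -> 'M[R]_(p, q)) :
  (m <= m')%N -> polymx m A -> polymx m' A.
Proof. by move=> mm pA i j; exact: polyf_le mm (pA i j). Qed.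

Lemma polymx_mul m p q r (A : G -> 'M[R]_(p, q)) (B : G -> 'M[R]_(q, r)) :
  polymx m A -> polymx m B -> polymx m.+1 (fun g => A g *m B g).
Proof.
move=> pA pB i j; have := polyf_sum (index_enum 'I_q)
  (fun k => polyf_mul (pA i k) (pB k j)).
by apply: eq_polyf => g; rewrite mxE.
Qed.

Lemma polymx_mulr m p q r (A : G -> 'M[R]_(p, q)) (B : 'M[R]_(q, r)) :
  polymx m A -> polymx m (fun g => A g *m B).
Proof.
move=> pA i j; have := polyf_sum (index_enum 'I_q)
  (fun k => polyf_scale (B k j) (pA i k)).
by apply: eq_polyf => g; rewrite mxE; apply: eq_bigr => k _; rewrite mulrC.
Qed.

Lemma polymx_mull m p q r (A : 'M[R]_(p, q)) (B : G -> 'M[R]_(q, r)) :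
  polymx m B -> polymx m (fun g => A *m B g).
Proof.
move=> pB i j; have := polyf_sum (index_enum 'I_q)
  (fun k => polyf_scale (A i k) (pB k j)).
by apply: eq_polyf => g; rewrite mxE.
Qed.

Lemma polymx_rep : polymx 0 (fun g => (rho g)^T).
Proof.
by move=> i j; apply: eq_polyf (polyf_entry j i) => g; rewrite mxE.
Qed.

(** Here [(rho g)^T] is [rho g^-1], and the entries are affine in those of [rho g]. *)
Lemma polymx_sam d (M : sym_affine_map R n d) (x : 'cV[R]_n) :
  polymx 0 (fun g => M ((rho g)^T *m x)).
Proof.
move=> i j; have px := polymx_mulr x polymx_rep.
have := polyf_add (polyf_cst 0 (sam_const M i j)) (polyf_sum (index_enum 'I_n)
  (fun k => polyf_scale (sam_coef M k i j) (px k 0))).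
apply: eq_polyf => g; rewrite /sam_eval mxE summxE; congr (_ + _).
by apply: eq_bigr => k _; rewrite [in RHS]mxE mulrC.
Qed.

Lemma polymx_exp m d (A : G -> 'M[R]_d) k :
  polymx m A -> polymx (m + k) (fun g => A g ^+ k).
Proof.
move=> pA; elim: k => [|k IH]; first exact: polymx_cst.
rewrite addnS => i j.
have := polymx_mul (polymx_le (leq_addr _ _) pA) IH i j.
by apply: eq_polyf => g; rewrite exprS.
Qed.

Lemma polyf_coef_prod m k (p : 'I_k -> G -> {poly R}) :
  (forall i j, polyf m (fun g => (p i g)`_j)) ->
  forall j, polyf (m + k) (fun g => (\prod_i p i g)`_j).
Proof.
elim: k p => [|k IH] p pp j.
  apply: eq_polyf (polyf_cst _ (1 : {poly R})`_j) => g.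
  by rewrite big_ord0.
rewrite addnS.
have IHp := IH (fun i => p (lift ord0 i)) (fun i => pp (lift ord0 i)).
have := polyf_sum (index_enum 'I_j.+1) (fun i : 'I_j.+1 =>
  polyf_mul (polyf_le (leq_addr k m) (pp ord0 i)) (IHp (j - i)%N)).
by apply: eq_polyf => g; rewrite [in RHS]big_ord_recl coefM.
Qed.

(** Leibniz expansion: each of the [d] factors of a term costs at most one level. *)
Lemma polyf_char_poly m d (A : G -> 'M[R]_d) k :
  polymx m A -> polyf (m + d) (fun g => (char_poly (A g))`_k).
Proof.
move=> pA.
have pE i j l : polyf m (fun g => (char_poly_mx (A g) i j)`_l).
  have := polyf_add (polyf_cst m (('X *+ (i == j))`_l))
     (polyf_scale (- (l == 0%N)%:R) (pA i j)).
  apply: eq_polyf => g; rewrite !mxE coefB coefC mulNr.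
  by case: (l == 0%N); rewrite ?mul1r ?mul0r.
have := polyf_sum (index_enum 'S_d) (fun s : 'S_d => polyf_scale ((-1) ^+ s)
  (polyf_coef_prod (fun i => pE i (s i)) k)).
apply: eq_polyf => g; rewrite /char_poly /determinant coef_sum.
apply: eq_bigr => s _.
by case: (odd_perm s); rewrite ?expr1 ?expr0 ?mulN1r ?mul1r ?coefN.
Qed.

(** Padding with zero coefficients lets [kerproj] be expanded over one range whatever its index. *)
Lemma horner_mx_wide d (A : 'M[R]_d.+1) (p : {poly R}) k :
  (size p <= k)%N -> horner_mx A p = \sum_(i < k) p`_i *: A ^+ i.
Proof.
move=> pk; have -> : p = \sum_(i < k) p`_i *: 'X^i.
  rewrite -poly_def; apply/polyP => i; rewrite coef_poly; case: ltnP => // ki.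
  by rewrite nth_default// (leq_trans pk).
rewrite rmorph_sum/=; apply: eq_bigr => i _.
rewrite -mul_polyC rmorphM rmorphXn/= horner_mx_X horner_mx_C -poly_def.
rewrite coef_poly ltn_ord; exact: mul_scalar_mx.
Qed.

Lemma polymx_kerproj m d (A : G -> 'M[R]_d.+1) k :
  polymx m A -> polymx (m + d.+2).+1 (fun g => kerproj (A g) k).
Proof.
move=> pA i j.
have pc l : polyf (m + d.+2) (fun g => (char_poly (A g))`_(l + k)).
  by apply: polyf_le (polyf_char_poly _ pA); rewrite leq_add2l.
have pX (l : 'I_d.+2) : polyf (m + d.+2) (fun g => (A g ^+ l) i j).
  by apply: polyf_le (polymx_exp l pA i j); rewrite leq_add2l ltnW.
have := polyf_sum (index_enum 'I_d.+2) (fun l => polyf_mul (pc l) (pX l)).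
apply: eq_polyf => g; rewrite /kerproj (@horner_mx_wide _ _ _ d.+2).
  rewrite summxE; apply: eq_bigr => l _.
  by rewrite mxE coef_drop_poly.
by rewrite size_drop_poly size_char_poly leq_subr.
Qed.

(** The column acted upon is the pure tensor of [u] and [v]. *)
Lemma tensmx_mul_col k l (A : 'M[R]_k) (B : 'M[R]_l) (u : 'cV[R]_k)
    (v : 'cV[R]_l) i j :
  (A *t B *m \col_p (u (mxtens_unindex p).1 0 * v (mxtens_unindex p).2 0))
    (mxtens_index (i, j)) 0 = (A *m u) i 0 * (B *m v) j 0.
Proof.
rewrite !mxE mulr_sum; apply: eq_bigr => p _.
by rewrite !mxE !mxtens_indexK mulrACA.
Qed.

(** All functions of one level are coefficients of a single orbit, so averaging them reduces to
    averaging that orbit. *)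
Lemma polyf_rep m : exists k (U : orthogonal_rep R G k) (b : 'cV[R]_k),
  (forall f, polyf m f ->
    exists a : 'rV[R]_k, forall g, f g = (a *m (U g *m b)) 0 0) /\
  polymx m (fun g => U g *m b).
Proof.
elim: m => [|m [k [U [b [spanU polyU]]]]].
  pose U := sum_rep (triv_rep R G 1) (tens_rep (triv_rep R G n) rho).
  (* The vector is 1 followed by the sum of the [e_j] tensor [e_j]; its orbit lists 1 and all
     entries of [rho g]. *)
  pose b : 'cV[R]_(1 + n * n) := col_mx 1%:M
    (\col_p ((mxtens_unindex p).1 == (mxtens_unindex p).2)%:R).
  have Ub1 g : (U g *m b) (lshift _ 0) 0 = 1.
    by rewrite mul_block_col col_mxEu mul0mx addr0 mul1mx mxE.
  have Ub2 g i j : (U g *m b) (rshift _ (mxtens_index (j, i))) 0 = rho g i j.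
    rewrite mul_block_col col_mxEd mul0mx add0r mxE.
    rewrite (bigD1 (mxtens_index (j, j)))// big1 => [|p].
      by rewrite tensmxE !mxE mxtens_indexK /= !eqxx mulr1 mul1r addr0.
    case: (mxtens_indexP p) => p1 p2; rewrite tensmxE !mxE mxtens_indexK/=.
    have [<-|] := eqVneq j p1; last by rewrite !mul0r.
    have [<-|] := eqVneq j p2; first by rewrite eqxx.
    by rewrite mulr0.
  exists (1 + n * n)%N, U, b; split.
    suff span0 m0 f : polyf m0 f -> m0 = 0%N ->
        exists a : 'rV[R]__, forall g, f g = (a *m (U g *m b)) 0 0.
      by move=> f pf; exact: span0 pf erefl.
    elim=> {m0 f} [i j|m0|m0 c f h _ IHf _ IHh|//] E.
    - exists (delta_mx 0 (rshift _ (mxtens_index (j, i)))) => g.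
      by rewrite -rowE mxE Ub2.
    - by exists (delta_mx 0 (lshift _ (0 : 'I_1))) => g; rewrite -rowE mxE Ub1.
    - have [[a fa] [a' ha']] := (IHf E, IHh E).
      exists (c *: a + a') => g.
      by rewrite fa ha' mulmxDl -scalemxAl !mxE.
  move=> i j; rewrite ord1 {j}; case: (split_ordP i) => {}i -> .
    by rewrite ord1; apply: eq_polyf (polyf_one 0) => g; rewrite Ub1.
  case: (mxtens_indexP i) => i1 i2.
  by apply: eq_polyf (polyf_entry i2 i1) => g; rewrite Ub2.
(* The tensor square of [b], whose orbit lists the pairwise products of the coordinates of
   [U g *m b]. *)
pose b' : 'cV[R]_(k * k) :=
  \col_p (b (mxtens_unindex p).1 0 * b (mxtens_unindex p).2 0).
have Ub g i j : (tens_rep U U g *m b') (mxtens_index (i, j)) 0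
    = (U g *m b) i 0 * (U g *m b) j 0 by exact: tensmx_mul_col.
have prod f h : polyf m f -> polyf m h -> exists a : 'rV[R]_(k * k),
    forall g, f g * h g = (a *m (tens_rep U U g *m b')) 0 0.
  move=> /spanU[a fa] /spanU[a' ha'].
  exists (\row_p (a 0 (mxtens_unindex p).1 * a' 0 (mxtens_unindex p).2)) => g.
  rewrite fa ha' mxE [X in _ * X]mxE mulr_sum [RHS]mxE.
  apply: eq_bigr => p _; case: (mxtens_indexP p) => p1 p2.
  by rewrite Ub !mxtens_indexK [in RHS]mxE mxtens_indexK mulrACA.
exists (k * k)%N, (tens_rep U U), b'; split.
  suff spanS m0 f : polyf m0 f -> m0 = m.+1 ->
      exists a : 'rV[R]__, forall g, f g = (a *m (tens_rep U U g *m b')) 0 0.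
    by move=> f pf; exact: spanS pf erefl.
  elim=> {m0 f} [//|m0 E|m0 c f h _ IHf _ IHh E|m0 f h pf _ ph _ [E]].
  - have [a ha] := prod _ _ (polyf_one m) (polyf_one m).
    by exists a => g; rewrite -ha mulr1.
  - have [[a fa] [a' ha']] := (IHf E, IHh E).
    exists (c *: a + a') => g.
    by rewrite fa ha' mulmxDl -scalemxAl !mxE.
  - by rewrite E in pf ph; exact: prod.
move=> i j; rewrite ord1 {j}; case: (mxtens_indexP i) => i1 i2.
by apply: eq_polyf (polyf_mul (polyU i1 0) (polyU i2 0)) => g; rewrite Ub.
Qed.

(* Haar integration, restricted to the functions of a given level. *)
Lemma polyf_mean m : compact [set: G] -> exists J : (G -> R) -> R,
  [/\ forall c f h, polyf m f -> polyf m h ->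
        J (fun g => c * f g + h g) = c * J f + J h,
      forall h f, polyf m f -> J (fun g => f (h * g)%g) = J f,
      forall f, polyf m f -> (forall g, 0 <= f g) -> 0 <= J f &
      forall f g0, polyf m f -> (forall g, 0 <= f g) -> 0 < f g0 -> 0 < J f].
Proof.
move=> Gc; have [k [U [b [spanU _]]]] := polyf_rep m.
have [A [UA hA]] := rep_average U b.
pose coefs f := [set a : 'rV[R]_k | forall g, f g = (a *m (U g *m b)) 0 0].
(* Any row representing [f] may be chosen: two of them agree on the orbit of [b], hence on [A]. The
   default 0 is taken only when [f] has no such row. *)
pose J f := (xget 0 (coefs f) *m A) 0 0.
have JE f a : coefs f a -> J f = (a *m A) 0 0.
  move=> fa; have : coefs f (xget 0 (coefs f)) by apply: xgetPex; exists a.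
  rewrite /J; move: (xget _ _) => a' fa'.
  apply/eqP; rewrite eq_le; apply/andP; split; rewrite -subr_ge0.
    have := hA (a - a') 0; rewrite mulmxBl !mxE; apply => g.
    by rewrite mulmxBl [leRHS]mxE [X in _ + X]mxE -fa -fa' subrr.
  have := hA (a' - a) 0; rewrite mulmxBl !mxE; apply => g.
  by rewrite mulmxBl [leRHS]mxE [X in _ + X]mxE -fa -fa' subrr.
exists J; split.
- move=> c f h /spanU[a fa] /spanU[a' ha'].
  rewrite (JE _ _ fa) (JE _ _ ha') (JE _ (c *: a + a')).
    by rewrite mulmxDl -scalemxAl !mxE.
  by move=> g; rewrite fa ha' mulmxDl -scalemxAl !mxE.
- move=> h f /spanU[a fa].
  rewrite (JE _ _ fa) (JE _ (a *m U h)); first by rewrite -mulmxA UA.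
  by move=> g; rewrite fa rep_mxM !mulmxA.
- move=> f /spanU[a fa] f0; rewrite (JE _ _ fa); apply: hA => g.
  by rewrite -fa.
- move=> f g0 /spanU[a fa] f0 fg0; rewrite (JE _ _ fa).
  by apply: (rep_average_gt Gc UA hA (g0 := g0)) => [g|]; rewrite -fa.
Qed.

End RepresentativeFunctions.

(** * Equivariant pencils *)

Lemma bil_delta (R : realType) d (A : 'M[R]_d) i j :
  bil A (delta_mx i 0) (delta_mx j 0) = A i j.
Proof. by rewrite /bil trmx_delta -rowE -colE !mxE. Qed.

Lemma sum_mxtens (V : nmodType) k l (F : 'I_(k * l) -> V) :
  \sum_p F p = \sum_i \sum_j F (mxtens_index (i, j)).
Proof.
rewrite pair_big; apply: reindex => /=.
exists (@mxtens_unindex k l) => [[i j]|p] _; first by rewrite mxtens_indexK.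
by rewrite -[RHS]mxtens_unindexK.
Qed.

Section AffineMaps.
Variables (R : realType) (n d : nat) (M : sym_affine_map R n d).

Lemma sam_eval_sym x : (M x)^T = M x.
Proof.
rewrite /sam_eval linearD/= sam_const_sym linear_sum/=; congr (_ + _).
by apply: eq_bigr => j _; rewrite linearZ/= sam_coef_sym.
Qed.

Lemma sam_eval_affine c x y : M (x + c *: (y - x)) = M x + c *: (M y - M x).
Proof.
rewrite /sam_eval opprD addrACA subrr add0r -addrA; congr (_ + _).
rewrite -sumrB scaler_sumr -big_split; apply: eq_bigr => j _ /=.
by rewrite !mxE -scalerBl scalerA -scalerDl.
Qed.

Lemma sam_eval_sum p (A : 'M[R]_(n, p)) (x : 'cV[R]_p) :
  M (A *m x) = M 0 + \sum_j x j 0 *: (M (col j A) - M 0).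
Proof.
rewrite /sam_eval; set M0 := (X in X + _).
rewrite [in RHS]big1 => [|j _]; last by rewrite mxE scale0r.
rewrite addr0; congr (_ + _).
under [RHS]eq_bigr do rewrite addrAC subrr add0r scaler_sumr.
rewrite exchange_big; apply: eq_bigr => i _ /=.
rewrite mxE scaler_suml; apply: eq_bigr => j _.
by rewrite mxE scalerA mulrC.
Qed.

(** For fixed [v] this is a constant plus a linear functional of [x], the shape to which
    [rep_average] applies. *)
Lemma bil_sam x v : bil (M x) v v =
  bil (sam_const M) v v + ((\row_j bil (sam_coef M j) v v) *m x) 0 0.
Proof.
rewrite /sam_eval bilDm; congr (_ + _).
rewrite mxE /bil mulmx_sumr mulmx_suml summxE; apply: eq_bigr => j _.
by rewrite -scalemxAr -scalemxAl !mxE mulrC.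
Qed.

Lemma map_sam d' (f : {linear 'M[R]_d -> 'M[R]_d'}) :
  (forall A, A^T = A -> (f A)^T = f A) ->
  exists M' : sym_affine_map R n d', forall x, M' x = f (M x).
Proof.
move=> fs; exists (SymAffineMap (fs _ (sam_const_sym M))
  (fun j => fs _ (sam_coef_sym M j))) => x.
rewrite /sam_eval/= linearD linear_sum; congr (_ + _).
by apply: eq_bigr => j _; rewrite linearZ.
Qed.

End AffineMaps.

(** * Averaging a pencil over the group *)

Section Averaging.
Variables (R : realType) (G : topologicalGroupType).
Hypothesis Gc : compact [set: G].
Variables (n : nat) (rho : orthogonal_rep R G n).

Lemma rep_mxKV g (x : 'cV[R]_n) : (rho g)^T *m (rho g *m x) = x.
Proof. by rewrite mulmxA rep_mx_orthogonal mul1mx. Qed.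

Section Pencil.
Variables (d m : nat) (M : sym_affine_map R n d).

(** The new form is the mean of the pulled-back forms on a space of maps containing every [phi] of
    level [m]. Invariance makes it nonnegative over the spectrahedron, and a witness makes it
    negative elsewhere. *)
Lemma equivariant_pencil :
  (forall g x, psdmx (M x) -> psdmx (M ((rho g)^T *m x))) ->
  (forall x, ~ psdmx (M x) -> exists phi : G -> 'cV[R]_d,
    [/\ polymx rho m phi,
      forall g, bil (M ((rho g)^T *m x)) (phi g) (phi g) <= 0 &
      exists g, bil (M ((rho g)^T *m x)) (phi g) (phi g) < 0]) ->
  exists k (V : orthogonal_rep R G k) (Mbar : sym_affine_map R n k),
    (forall g x, Mbar (rho g *m x) = sym2_act V g (Mbar x)) /\
    (forall x, psdmx (Mbar x) <-> psdmx (M x)).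
Proof.
move=> Minv wit.
have [K [U [b [spanU polyU]]]] := polyf_rep rho m.
(* Two extra levels for the products with [W g] on both sides of the pencil. *)
have [J [Jlin Jinv Jge0 Jgt0]] := polyf_mean rho m.+2 Gc.
pose k := (d * K)%N.
pose V : orthogonal_rep R G k := tens_rep (triv_rep R G d) U.
(* Column [i] is [e_i] tensor [U g *m b], so [(W g)^T] evaluates at [g] the map encoded by a vector
   of [V]. *)
pose W g : 'M[R]_(k, d) := \matrix_(p, i)
  ((delta_mx i 0 : 'cV[R]_d) (mxtens_unindex p).1 0
   * (U g *m b) (mxtens_unindex p).2 0).
have WM h g : W (h * g)%g = V h *m W g.
  apply/matrixP => p i; case: (mxtens_indexP p) => p1 p2.
  have := tensmx_mul_col (1%:M : 'M[R]_d) (U h) (delta_mx i 0) (U g *m b) p1 p2.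
  rewrite mul1mx (mulmxA (U h)) -rep_mxM => E.
  rewrite mxE mxtens_indexK -E [LHS]mxE [RHS]mxE.
  by apply: eq_bigr => q _; congr (_ * _); rewrite !mxE.
have polyW : polymx rho m W.
  move=> p i; apply: eq_polyf (polyf_scale
    ((delta_mx i 0 : 'cV[R]_d) (mxtens_unindex p).1 0)
    (polyU (mxtens_unindex p).2 0)) => g.
  by rewrite [RHS]mxE.
pose P x g := W g *m M ((rho g)^T *m x) *m (W g)^T.
have polyP x : polymx rho m.+2 (P x).
  apply: polymx_mul.
    by apply: polymx_mul polyW (polymx_le (leq0n m) (polymx_sam rho M x)).
  move=> i p; apply: polyf_le (leqnSn m) _.
  by apply: eq_polyf (polyW p i) => g; rewrite [RHS]mxE.
have Ps x g : (P x g)^T = P x g.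
  by rewrite /P !trmx_mul trmxK sam_eval_sym mulmxA.
have J0 : J (fun=> 0) = 0.
  have := Jlin (-1) _ _ (polyf_one rho _) (polyf_one rho _).
  by rewrite !mulN1r !addNr.
have JZ c f : polyf rho m.+2 f -> J (fun g => c * f g) = c * J f.
  move=> pf; have := Jlin c f (fun=> 0) pf (polyf_cst _ _ 0).
  by rewrite J0 addr0 => <-; congr J; apply/funext => g; rewrite addr0.
have JD f h : polyf rho m.+2 f -> polyf rho m.+2 h ->
    J (fun g => f g + h g) = J f + J h.
  move=> pf ph; have := Jlin 1 f h pf ph; rewrite mul1r => <-.
  by congr J; apply/funext => g; rewrite mul1r.
have Jsum I (s : seq I) f : (forall i, polyf rho m.+2 (f i)) ->
    J (fun g => \sum_(i <- s) f i g) = \sum_(i <- s) J (f i).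
  move=> pf; elim: s => [|i s IH].
    by rewrite big_nil -[RHS]J0; congr J; apply/funext => g; rewrite big_nil.
  rewrite big_cons -IH -JD//; last exact: polyf_sum.
  by congr J; apply/funext => g; rewrite big_cons.
pose B x : 'M[R]_k := \matrix_(p, q) J (fun g => P x g p q).
have Bs x : (B x)^T = B x.
  apply/matrixP => p q; rewrite !mxE; congr J; apply/funext => g.
  by rewrite -{1}Ps mxE.
have polyB x v w : polyf rho m.+2 (fun g => bil (P x g) v w).
  have := polyf_sum (index_enum 'I_k) (fun i => polyf_sum (index_enum 'I_k)
    (fun j => polyf_scale (v i 0 * w j 0) (polyP x i j))).
  apply: eq_polyf => g; rewrite bilE; apply: eq_bigr => i _.
  by apply: eq_bigr => j _; rewrite mulrAC.
have bilB x v w : bil (B x) v w = J (fun g => bil (P x g) v w).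
  have E : (fun g => bil (P x g) v w) =
      fun g => \sum_i \sum_j (v i 0 * w j 0) * P x g i j.
    apply/funext => g; rewrite bilE; apply: eq_bigr => i _.
    by apply: eq_bigr => j _; rewrite mulrAC.
  rewrite E Jsum => [|i]; last first.
    by apply: polyf_sum => j; apply: polyf_scale; exact: polyP.
  rewrite bilE; apply: eq_bigr => i _; rewrite Jsum => [|j]; last first.
    by apply: polyf_scale; exact: polyP.
  by apply: eq_bigr => j _; rewrite (JZ _ _ (polyP x i j)) mxE mulrAC.
have Beq g x : B (rho g *m x) = sym2_act V g (B x).
  rewrite /sym2_act rep_mxV trmxK; apply/matrixP => p q.
  have -> : (V g *m B x *m (V g)^T) p q =
      bil (B x) ((V g)^T *m delta_mx p 0) ((V g)^T *m delta_mx q 0).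
    by rewrite bilMM trmxK bil_delta.
  (* Invariance of the mean replaces [h] by [g * h]; then [W] yields the factors [V g], and [rho g]
     cancels in the pencil. *)
  rewrite bilB mxE -(Jinv g _ (polyP _ p q)); congr J; apply/funext => h.
  rewrite bilMM trmxK bil_delta /P WM rep_mxM !trmx_mul.
  by rewrite -[(rho h)^T *m _ *m _]mulmxA rep_mxKV !mulmxA.
have Baff x : B x = B 0 + \sum_j x j 0 *: (B (delta_mx j 0) - B 0).
  apply/matrixP => p q; rewrite [RHS]mxE summxE.
  have PE g : P x g p q = P 0 g p q +
      \sum_j x j 0 * (P (delta_mx j 0) g p q + -1 * P 0 g p q).
    rewrite /P mulmx0 sam_eval_sum mulmxDr mulmxDl mxE; congr (_ + _).
    rewrite mulmx_sumr mulmx_suml summxE; apply: eq_bigr => j _.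
    rewrite -scalemxAr -scalemxAl mxE colE; congr (_ * _).
    by rewrite mulmxBr mulmxBl [LHS]mxE [X in _ + X = _]mxE mulN1r.
  have pE j : polyf rho m.+2
      (fun g => P (delta_mx j 0) g p q + -1 * P 0 g p q).
    exact: polyf_add (polyP _ p q) (polyf_scale _ (polyP _ p q)).
  transitivity (J (fun g => P 0 g p q +
      \sum_j x j 0 * (P (delta_mx j 0) g p q + -1 * P 0 g p q))).
    by rewrite mxE; congr J; apply/funext.
  rewrite JD; [|exact: polyP|by apply: polyf_sum => j; exact: polyf_scale].
  rewrite Jsum => [|j]; last exact: polyf_scale.
  rewrite [in RHS]mxE; congr (_ + _); apply: eq_bigr => j _.
  rewrite JZ// JD; [|exact: polyP|by apply: polyf_scale; exact: polyP].
  by rewrite (JZ _ _ (polyP 0 p q)) !mxE mulN1r.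
have coefs j : (B (delta_mx j 0) - B 0)^T = B (delta_mx j 0) - B 0.
  by rewrite linearB/= !Bs.
exists k, V, (SymAffineMap (Bs 0) coefs).
have BE x : SymAffineMap (Bs 0) coefs x = B x by rewrite [RHS]Baff.
split=> [g x|x]; first by rewrite !BE Beq.
have bilP g v : bil (P x g) v v =
    bil (M ((rho g)^T *m x)) ((W g)^T *m v) ((W g)^T *m v).
  by rewrite bilMM trmxK.
rewrite BE; split => [Bp|Mp].
  apply: contrapT => /wit[phi [polyphi phi_le [g0 phi_lt]]].
  have /choice[a aE] : forall i : 'I_d, exists a : 'rV[R]_K, forall g,
      phi g i 0 = (a *m (U g *m b)) 0 0.
    by move=> i; apply: spanU; exact: polyphi.
  (* The vector encoding [phi]: block [i] holds the coefficients of its [i]-th component. *)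
  pose v : 'cV[R]_k :=
    \col_p a (mxtens_unindex p).1 0 (mxtens_unindex p).2.
  have Wv g : (W g)^T *m v = phi g.
    apply/matrixP => i j; rewrite ord1 {j} aE !mxE sum_mxtens (bigD1 i)//=.
    rewrite [X in _ + X]big1 => [|i' ii']; last first.
      rewrite big1// => l _; rewrite !mxE mxtens_indexK/=.
      by rewrite (negPf ii') !mul0r.
    rewrite addr0; apply: eq_bigr => l _.
    by rewrite !mxE !mxtens_indexK/= !eqxx mul1r mulrC.
  have := Bp v; rewrite -/(bil _ _ _) bilB leNgt => /negP; apply.
  rewrite -oppr_gt0 -mulN1r -JZ//.
  apply: (Jgt0 _ g0); first exact: polyf_scale.
    by move=> g; rewrite mulN1r oppr_ge0 bilP Wv.
  by rewrite mulN1r oppr_gt0 bilP Wv.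
move=> v; rewrite -/(bil _ _ _) bilB; apply: Jge0 => // g.
by rewrite bilP; exact: Minv.
Qed.

End Pencil.
End Averaging.

(** * Witnesses of negativity outside an invariant spectrahedron *)

Section Spectrahedron.
Variables (R : realType) (G : topologicalGroupType).
Hypothesis Gc : compact [set: G].
Variables (n : nat) (rho : orthogonal_rep R G n).

Section RelativeInterior.
Variables (d : nat) (M : sym_affine_map R n d).

(** The kernel at the midpoint of [x0] and [x] is the intersection of the two kernels, so maximality
    of the rank at [x0] forces the midpoint to have the row space of [M x0]. *)
Lemma max_rank_point : (exists x, psdmx (M x)) ->
  exists x0, psdmx (M x0) /\ forall x, psdmx (M x) -> (M x <= M x0)%MS.
Proof.
move=> [x1 x1p].
pose P (r : nat) := `[< exists x, psdmx (M x) /\ \rank (M x) = r >].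
have Pex : exists r, P r by exists (\rank (M x1)); apply/asboolP; exists x1.
have Pub r : P r -> (r <= d)%N.
  by move=> /asboolP[x [_ <-]]; exact: rank_leq_row.
case: (ex_maxnP Pex Pub) => r /asboolP[x0 [x0p x0r]] rmax.
exists x0; split => // x xp.
pose z := x0 + 2^-1 *: (x - x0).
have ME : M z = 2^-1 *: (M x0 + M x).
  rewrite /z sam_eval_affine; move: (M x0) (M x) => A B.
  by apply/matrixP => i j; rewrite !mxE; field.
have h0 : (0 : R) < 2^-1 by rewrite invr_gt0.
have zp : psdmx (M z).
  move=> v; rewrite ME -/(bil _ _ _) bilZm bilDm.
  rewrite mulr_ge0 ?(ltW h0)// addr_ge0//.
    exact: x0p.
  exact: xp.
have kerz (v : 'cV[R]_d) : M z *m v = 0 -> M x0 *m v = 0 /\ M x *m v = 0.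
  move=> zv; have : bil (M z) v v = 0 by rewrite /bil -mulmxA zv mulmx0 mxE.
  rewrite ME bilZm bilDm => /eqP; rewrite mulf_eq0 gt_eqF//=.
  rewrite paddr_eq0; [|exact: x0p|exact: xp] => /andP[/eqP h1 /eqP h2].
  by split; apply: psd_bil_eq0 => //; exact: sam_eval_sym.
have x0z : (M x0 <= M z)%MS by apply: sub_ker_submx => v /kerz[].
have xz : (M x <= M z)%MS by apply: sub_ker_submx => v /kerz[].
apply: submx_trans xz _.
have := geq_leqif (mxrank_leqif_sup x0z); rewrite x0r => <-.
by apply: rmax; apply/asboolP; exists z.
Qed.

(** Averaging the orbit of a maximal-rank point keeps it in the spectrahedron. Its kernel does not
    grow: a form positive at [x0] stays positive at the average by [rep_average_gt]. *)
Lemma fixed_max_rank_point :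
  (forall g x, psdmx (M x) -> psdmx (M (rho g *m x))) ->
  (exists x, psdmx (M x)) ->
  exists xb, [/\ forall g, rho g *m xb = xb, psdmx (M xb) &
    forall x, psdmx (M x) -> kermx (M xb) *m M x = 0].
Proof.
move=> Minv /max_rank_point[x0 [x0p x0max]].
have [xb [xbf hxb]] := rep_average rho x0.
exists xb; split => //.
  move=> v; rewrite -/(bil _ _ _) bil_sam -lerBlDl; apply: hxb => g.
  by rewrite lerBlDl -bil_sam; exact: Minv.
move=> x xp.
have kerb (v : 'cV[R]_d) : M xb *m v = 0 -> M x0 *m v = 0.
  move=> bv; apply: psd_bil_eq0 => //; first exact: sam_eval_sym.
  apply/eqP; rewrite eq_le x0p andbT leNgt; apply/negP => v_gt0.
  have := rep_average_gt Gc xbf hxb (l := \row_j bil (sam_coef M j) v v)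
    (c := 0 - bil (sam_const M) v v) (g0 := 1%g).
  rewrite ltrBlDl -bil_sam rep_mx1 mul1mx ltrBlDl -bil_sam => H.
  suff : 0 < bil (M xb) v v by rewrite /bil -mulmxA bv mulmx0 mxE ltxx.
  by apply: H => // g; rewrite lerBlDl -bil_sam; exact: Minv.
have /submxP[D xD] : (M x <= M xb)%MS.
  exact: submx_trans (x0max x xp) (sub_ker_submx kerb).
rewrite -[M x]sam_eval_sym xD trmx_mul mulmxA sam_eval_sym mulmx_ker.
by rewrite mul0mx.
Qed.

End RelativeInterior.

Section KernelBlock.
Variables (d : nat) (C : 'M[R]_d).

(* On symmetric matrices [A] this is positive semidefinite iff [A] is and
   [C *m A = 0]. *)
Definition kerblock (A : 'M[R]_d) : 'M[R]_(d + (d + d)) :=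
  block_mx A 0 0 (block_mx 0 (C *m A) (A *m C^T) 0).

Fact kerblock_is_linear : linear kerblock.
Proof.
move=> c A B; rewrite /kerblock scale_block_mx add_block_mx.
rewrite scale_block_mx add_block_mx !scaler0 !addr0.
by rewrite mulmxDr mulmxDl -scalemxAr -scalemxAl.
Qed.

HB.instance Definition _ := GRing.isLinear.Build R 'M[R]_d 'M[R]_(d + (d + d))
  _ kerblock kerblock_is_linear.

Lemma kerblock_sym A : A^T = A -> (kerblock A)^T = kerblock A.
Proof.
by move=> As; rewrite /kerblock !tr_block_mx !trmx0 !trmx_mul trmxK As.
Qed.

Lemma bil_kerblock A a b c : A^T = A ->
  bil (kerblock A) (col_mx a (col_mx b c)) (col_mx a (col_mx b c)) =
  bil A a a + 2 * bil (C *m A) b c.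
Proof.
move=> As; rewrite /bil /kerblock !tr_col_mx !mul_row_block !mul_row_col.
rewrite !mulmx0 !addr0 !add0r mul_row_col mxE [X in _ + X]mxE; congr (_ + _).
have -> : (c^T *m (A *m C^T) *m b) 0 0 = (c^T *m (A *m C^T) *m b)^T 0 0.
  by rewrite [RHS]mxE.
by rewrite !trmx_mul !trmxK As !mulmxA; lra.
Qed.

(** A semidefinite matrix with zero diagonal blocks has zero off-diagonal blocks. *)
Lemma psd_kerblock A : A^T = A ->
  psdmx (kerblock A) <-> psdmx A /\ C *m A = 0.
Proof.
move=> As; split => [Bp|[Ap CA0]].
  have Bp' a b c : 0 <= bil A a a + 2 * bil (C *m A) b c.
    by rewrite -bil_kerblock//; exact: Bp.
  split=> [a|].
    by have := Bp' a 0 0; rewrite [X in 2 * X]/bil mulmx0 mxE mulr0 addr0.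
  apply/matrixP => i j; rewrite [RHS]mxE; apply/eqP; rewrite -sqrf_eq0.
  rewrite eq_le sqr_ge0 andbT.
  (* The form takes the value [- 2 * (C *m A) i j ^+ 2] at this vector. *)
  have := Bp' 0 (delta_mx i 0) (- (C *m A) i j *: delta_mx j 0).
  by rewrite bilZr bil_delta {1}/bil mulmx0 [X in X + _]mxE expr2; lra.
move=> v; rewrite -/(bil _ _ _) -[v]vsubmxK -[dsubmx v]vsubmxK bil_kerblock//.
by rewrite CA0 {2}/bil mulmx0 mul0mx mxE mulr0 addr0; exact: Ap.
Qed.

End KernelBlock.
Section Witness.
Variables (d : nat) (M : sym_affine_map R n d.+1) (xb : 'cV[R]_n).
Hypothesis Minv : forall g x, psdmx (M x) -> psdmx (M (rho g *m x)).
Hypothesis xb_fixed : forall g, rho g *m xb = xb.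
Hypothesis xb_psd : psdmx (M xb).

Let C := kermx (M xb).

Lemma psd_act g x : psdmx (M ((rho g)^T *m x)) <-> psdmx (M x).
Proof.
rewrite -rep_mxV; split => [/(Minv g)|]; last exact: Minv.
by rewrite mulmxA -rep_mxM mulgV rep_mx1 mul1mx.
Qed.

Lemma kernel_witness x : ~ psdmx (M x) ->
  (forall g, C *m M ((rho g)^T *m x) = 0) ->
  exists phi : G -> 'cV[R]_d.+1,
    [/\ polymx rho d.+3 phi,
      forall g, bil (M ((rho g)^T *m x)) (phi g) (phi g) <= 0 &
      exists g, bil (M ((rho g)^T *m x)) (phi g) (phi g) < 0].
Proof.
move=> nMx CM; pose Z := M xb; pose N g := M ((rho g)^T *m x) - Z.
have ME g s : Z + s *: N g = M ((rho g)^T *m (xb + s *: (x - xb))).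
  rewrite mulmxDr -scalemxAr mulmxBr -rep_mxV xb_fixed sam_eval_affine.
  by rewrite /N rep_mxV.
have M1 g : Z + N g = M ((rho g)^T *m x) by rewrite /N addrC subrK.
have Zs : Z^T = Z by exact: sam_eval_sym.
have Ns g : (N g)^T = N g by rewrite linearB/= !sam_eval_sym.
(* As [xb] is fixed, [psd_act] makes the parameter found at the unit valid for every [g]. *)
have [t [t01 tp tmax]] : exists t, [/\ 0 <= t < 1, psdmx (Z + t *: N 1%g) &
    forall s, t < s <= 1 -> ~ psdmx (Z + s *: N 1%g)].
  by apply: psd_segment_last => //; rewrite M1 psd_act.
pose X g := Z + t *: N g.
have kerX g : exists2 v, X g *m v = 0 & 0 < bil Z v v.
  have ZN : kermx Z *m N g = 0 by rewrite /N mulmxBr CM mulmx_ker subr0.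
  apply: (psd_segment_kernel Zs (Ns g) xb_psd ZN t01).
    by rewrite ME psd_act; move: tp; rewrite ME psd_act.
  by move=> s ts; rewrite ME psd_act; move: (tmax s ts); rewrite ME psd_act.
(* The least such [k] serves all [g] at once: lower coefficients vanish identically, so
   [kerproj (X g) k] always maps into the kernel of [X g], and at [g0] it is a nonzero multiple of
   the projection. At other [g] it may vanish. *)
pose P k := `[< exists g, (char_poly (X g))`_k != 0 >].
have Pex : exists k, P k.
  exists d.+1; apply/asboolP; exists 1%g.
  have /monicP := char_poly_monic (X 1%g).
  by rewrite lead_coefE size_char_poly/= => ->; exact: oner_neq0.
case: (ex_minnP Pex) => k /asboolP[g0 g0k] kmin.
have [v Xv Zv] := kerX g0.
have Xs g : (X g)^T = X g by rewrite linearD/= linearZ/= Zs Ns.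
have Xker g : X g *m kerproj (X g) k = 0.
  apply: mul_kerproj => // i ik; apply/eqP/negPn/negP => Xi.
  by have := kmin i (asboolT (ex_intro _ g Xi)); rewrite leqNgt ik.
pose phi g := kerproj (X g) k *m v.
(* The form of [X g] vanishes at [phi g] and is the combination of the forms at [xb] and [x] with
   weights [1 - t] and [t]. *)
have kerM g : t * bil (M ((rho g)^T *m x)) (phi g) (phi g) =
    - ((1 - t) * bil Z (phi g) (phi g)).
  have : bil (X g) (phi g) (phi g) = 0.
    by rewrite /bil -mulmxA (mulmxA (X g)) Xker mul0mx mulmx0 mxE.
  rewrite bilDm bilZm -M1 bilDm mulrDr => /eqP.
  by rewrite addrC addr_eq0 => /eqP ->; rewrite mulrBl mul1r opprB.
have [t0 t1] : 0 < t /\ t < 1.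
  case/andP: t01 => t0 t1; split => //; rewrite lt_neqAle t0 andbT eq_sym.
  (* If [t] were 0, [v] would lie in the kernel of [Z], against [Zv]. *)
  apply/eqP => t0'; move: Xv; rewrite /X t0' scale0r addr0 => Zv0.
  by move: Zv; rewrite /bil -mulmxA Zv0 mulmx0 mxE ltxx.
exists phi; split.
- apply: polymx_mulr; apply: (@polymx_kerproj _ _ _ rho 0 d X k) => i j.
  have := polymx_sam rho M (xb + t *: (x - xb)) i j.
  by apply: eq_polyf => g; rewrite -ME.
- move=> g; rewrite -(pmulr_rle0 _ t0) kerM oppr_le0.
  by apply: mulr_ge0; [rewrite subr_ge0 ltW | exact: xb_psd].
- exists g0; rewrite -(pmulr_rlt0 _ t0) kerM oppr_lt0.
  apply: mulr_gt0; first by rewrite subr_gt0.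
  rewrite /phi kerproj_mul// bilZl bilZr mulrA -expr2.
  by rewrite mulr_gt0// exprn_even_gt0.
Qed.

(** If [C] kills the pencil at every translate of [x], [kernel_witness] is padded with zeros.
    Otherwise a nonzero entry of [C *m M] at some translate gives a witness in the off-diagonal
    blocks. *)
Lemma kerblock_witness x : ~ psdmx (kerblock C (M x)) ->
  (forall y, psdmx (M y) -> C *m M y = 0) ->
  exists phi : G -> 'cV[R]_(d.+1 + (d.+1 + d.+1)), [/\ polymx rho d.+3 phi,
    forall g, bil (kerblock C (M ((rho g)^T *m x))) (phi g) (phi g) <= 0 &
    exists g, bil (kerblock C (M ((rho g)^T *m x))) (phi g) (phi g) < 0].
Proof.
move=> nBx Ckill.
have nMx : ~ psdmx (M x).
  move=> Mx; apply: nBx; apply/psd_kerblock; first exact: sam_eval_sym.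
  by split => //; exact: Ckill.
have [CM|] := pselect (forall g, C *m M ((rho g)^T *m x) = 0).
  have [phi [pphi phi_le [g0 phi_lt]]] := kernel_witness nMx CM.
  have E g : bil (kerblock C (M ((rho g)^T *m x))) (col_mx (phi g) (col_mx 0 0))
      (col_mx (phi g) (col_mx 0 0)) = bil (M ((rho g)^T *m x)) (phi g) (phi g).
    rewrite bil_kerblock; last exact: sam_eval_sym.
    by rewrite [X in 2 * X]/bil mulmx0 mxE mulr0 addr0.
  exists (fun g => col_mx (phi g) (col_mx 0 0)); split.
  - move=> i j; case: (split_ordP i) => {}i ->.
      by apply: eq_polyf (pphi i j) => g; rewrite col_mxEu.
    apply: eq_polyf (polyf_cst _ _ 0) => g.
    rewrite col_mxEd; case: (split_ordP i) => {}i ->.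
      by rewrite col_mxEu mxE.
    by rewrite col_mxEd mxE.
  - by move=> g; rewrite E.
  - by exists g0; rewrite E.
move=> /existsNP[g0 CM0].
have [i [j CMij]] : exists i j, (C *m M ((rho g0)^T *m x)) i j != 0.
  apply: contrapT => H; apply: CM0; apply/matrixP => i j; rewrite [RHS]mxE.
  by apply/eqP/negPn/negP => h; apply: H; exists i, j.
pose c g := (C *m M ((rho g)^T *m x)) i j.
(* The coefficient [- c g] turns the bilinear term into minus a square for every [g], nonzero at
   [g0]. *)
pose phi g : 'cV[R]_(d.+1 + (d.+1 + d.+1)) :=
  col_mx 0 (col_mx (delta_mx i 0) (- c g *: delta_mx j 0)).
have E g : bil (kerblock C (M ((rho g)^T *m x))) (phi g) (phi g) =
    - (2 * c g ^+ 2).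
  rewrite bil_kerblock; last exact: sam_eval_sym.
  rewrite bilZr bil_delta -/(c g) {1}/bil mulmx0 [X in X + _]mxE; ring.
exists phi; split.
- apply: (@polymx_le _ _ _ _ 0) => // p q; case: (split_ordP p) => {}p ->.
    by apply: eq_polyf (polyf_cst _ _ 0) => g; rewrite col_mxEu mxE.
  case: (split_ordP p) => {}p ->.
    apply: eq_polyf (polyf_cst _ _ ((delta_mx i 0 : 'cV[R]_d.+1) p q)) => g.
    by rewrite col_mxEd col_mxEu.
  have pc := polymx_mull C (polymx_sam rho M x) i j.
  apply: eq_polyf (polyf_scale (- (delta_mx j 0 : 'cV[R]_d.+1) p q) pc) => g.
  by rewrite !col_mxEd [RHS]mxE mulNr mulrC mulNr.
- by move=> g; rewrite E oppr_le0 mulr_ge0// sqr_ge0.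
- exists g0; rewrite E oppr_lt0.
  by rewrite mulr_gt0// exprn_even_gt0.
Qed.

End Witness.

Lemma equivariant_pencil_nonempty d (M : sym_affine_map R n d.+1) :
  (forall g x, psdmx (M x) -> psdmx (M (rho g *m x))) ->
  (exists x, psdmx (M x)) ->
  exists k (V : orthogonal_rep R G k) (Mbar : sym_affine_map R n k),
    (forall g x, Mbar (rho g *m x) = sym2_act V g (Mbar x)) /\
    (forall x, psdmx (Mbar x) <-> psdmx (M x)).
Proof.
move=> Minv Mex.
have [xb [xbf xbp xbker]] := fixed_max_rank_point Minv Mex.
pose C := kermx (M xb).
have [M' M'E] := map_sam M (@kerblock_sym _ C).
have M'p x : psdmx (M' x) <-> psdmx (M x).
  rewrite M'E psd_kerblock; last exact: sam_eval_sym.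
  by split=> [[]//|Mx]; split => //; exact: xbker.
have [||k [V [Mbar [eqv Mbarp]]]] :=
  @equivariant_pencil R G Gc n rho _ d.+3 M'.
- by move=> g x /M'p Mx; apply/M'p; rewrite -rep_mxV; exact: Minv.
- move=> x nM'x; have nBx : ~ psdmx (kerblock C (M x)) by rewrite -M'E.
  have [phi [h1 h2 [g h3]]] := kerblock_witness Minv xbf xbp nBx xbker.
  exists phi; split => //; last by exists g; rewrite M'E.
  by move=> h; rewrite M'E; exact: h2.
- exists k, V, Mbar; split => // x.
  by split=> [/Mbarp/M'p|/M'p/Mbarp].
Qed.

End Spectrahedron.

Theorem theorem1 (R : realType) (G : lieGroupType R)
  (G_compact : compact [set: G])
  (n : nat) (rho : orthogonal_rep R G n) (S : set 'cV[R]_n)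
  (S_spectrahedron : spectrahedron S)
  (S_invariant : forall g : G, [set rho g *m x | x in S] = S) :
  exists (k : nat) (V : orthogonal_rep R G k) (Mbar : sym_affine_map R n k),
    (forall (g : G) (x : 'cV[R]_n),
        Mbar (rho g *m x) = sym2_act V g (Mbar x)) /\
    S = [set x | psdmx (Mbar x)].
Proof.
case: S_spectrahedron => d [M SE].
have cst_pencil k (A : 'M[R]_k) : A^T = A ->
    exists Mbar : sym_affine_map R n k, forall x, Mbar x = A.
  move=> As; exists (SymAffineMap As (fun _ : 'I_n => trmx0 R k k)) => x.
  by rewrite /sam_eval/= big1 ?addr0// => j _; rewrite scaler0.
have Minv g x : psdmx (M x) -> psdmx (M (rho g *m x)).
  move=> Mx; have : S (rho g *m x).
    by rewrite -(S_invariant g); exists x; rewrite ?SE.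
  by rewrite SE.
(* In size 0 semidefiniteness is vacuous and [S] is the whole space. *)
case: d => [|d] in M SE Minv *.
  have [Mbar ME] := cst_pencil 0%N 0 (trmx0 _ _ _).
  exists 0%N, (triv_rep R G 0), Mbar; split.
    by move=> g x; rewrite !ME /sym2_act mulmx0 mul0mx.
  rewrite SE; apply/seteqP; split => x _ v.
    by rewrite ME mulmx0 mul0mx mxE.
  by rewrite thinmx0 mul0mx mxE.
have [Mex|Mex] := pselect (exists x, psdmx (M x)).
  have [k [V [Mbar [eqv Mbarp]]]] :=
    equivariant_pencil_nonempty G_compact Minv Mex.
  exists k, V, Mbar; split => //.
  by rewrite SE; apply/seteqP; split => x /Mbarp.
(* The empty set is cut out by the constant -1 on the trivial line. *)
have [Mbar ME] := cst_pencil 1%N (- 1%:M) (ltac:(by rewrite linearN/= trmx1)).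
exists 1%N, (triv_rep R G 1), Mbar; split.
  by move=> g x; rewrite !ME /sym2_act/= trmx1 mul1mx mulmx1.
rewrite SE; apply/seteqP; split => x /= Mx; first by case: Mex; exists x.
have := Mx 1%:M; rewrite ME trmx1 mul1mx mulmx1 !mxE/= oppr_ge0.
by rewrite ler10.
Qed.
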